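(* Let $\mathbb{K}$ be an algebraically closed field, let $n\geq 2$ and $r\ge 1$ be integers, let $(d_1,\dots,d_n)\in\mathbb{Z}_{\ge 0}^n$ and $(m_1,\dots,m_r)\in\mathbb{Z}_{\ge 0}^r$. Let $k$ be an integer with $1\le k\le d_n$ and let $s$ be an integer with $1\le s\le r$. Let $q_1,\dots,q_r\in(\mathbb{P}^1)^n$ be points in very general position and consider the linear systems $$\mathcal{L}_1:=\mathcal{L}_{(d_1,\dots,d_{n-1},k-1)}(m_1,\dots,m_s),\qquad \mathcal{L}_2:=\mathcal{L}_{(d_1,\dots,d_{n-1},d_n-k)}(m_{s+1},\dots,m_r),$$ with multiplicities imposed at $q_1,\dots,q_s$ and at $q_{s+1},\dots,q_r$ respectively. Assume that the following conditions hold: 1. $\mathcal{L}_1$ and $\mathcal{L}_2$ are fiber non-special and $(\operatorname{fdim}(\mathcal{L}_1)+1)(\operatorname{fdim}(\mathcal{L}_2)+1)\geq 0$; 2. $m_i\leq k$ for every $i\in\{1,\dots,s\}$; 3. $m_j\leq d_n-k+1$ for every $j\in\{s+1,\dots,r\}$. Then the linear system $\mathcal{L}:=\mathcal{L}_{(d_1,\dots,d_n)}(m_1,\dots,m_r)$, with multiplicities imposed at $q_1,\dots,q_r$, is fiber non-special.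
   Context: For $(\delta_1,\dots,\delta_n)\in\mathbb{Z}_{\ge0}^n$ and points $p_1,\dots,p_t\in(\mathbb{P}^1)^n$ with multiplicities $\mu_1,\dots,\mu_t\in\mathbb{Z}_{\ge0}$ (possibly $t=0$), the linear system $\mathcal{M}=\mathcal{L}_{(\delta_1,\dots,\delta_n)}(\mu_1,\dots,\mu_t)$ is the system of hypersurfaces of multidegree $(\delta_1,\dots,\delta_n)$ in $(\mathbb{P}^1)^n$ with multiplicity at least $\mu_j$ at $p_j$ for all $j$. $V(\mathcal{M})$ denotes the $\mathbb{K}$-vector space of multihomogeneous polynomials in $\mathbb{K}[x_1,y_1,\dots,x_n,y_n]$ of that multidegree (degree $\delta_i$ in the pair $x_i,y_i$) satisfying these multiplicity conditions (no condition if $\mu_j=0$), and $\dim(\mathcal{M})=\dim_{\mathbb{K}}V(\mathcal{M})-1$ (so the empty system has dimension $-1$). Distinct points $q_1,\dots,q_r\in(\mathbb{P}^1)^n$ are in very general position if, for every $d\in\mathbb{Z}_{\ge0}^n$ and $m\in\mathbb{Z}_{\ge0}^r$, the dimension of the space of multihomogeneous polynomials of multidegree $d$ with multiplicity at least $m_j$ at $q_j$ for all $j$ attains the minimal value among all $r$-tuples of distinct points of $(\mathbb{P}^1)^n$. For $I\subseteq\{1,\dots,n\}$ put $S_I=1+|I|+\sum_{i\in I}\delta_i$ (computed with the multidegree of the system $\mathcal{M}$ under consideration; $S_\emptyset=1$). Fiber dimension and fiber-expected dimension: $$\operatorname{fdim}(\mathcal{M})=\prod_{i=1}^n(\delta_i+1)-\sum_{\substack{1\le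 j\le t,\ I\subseteq\{1,\dots,n\}\\ S_I\le \mu_j}}(-1)^{|I|}\binom{\mu_j-S_I+n}{n}-1,\qquad \operatorname{efdim}(\mathcal{M})=\max(-1,\operatorname{fdim}(\mathcal{M})).$$ $\mathcal{M}$ is fiber special if $\dim(\mathcal{M})>\operatorname{efdim}(\mathcal{M})$, and fiber non-special otherwise. *)

(* Defs.v *)
From HB Require Import structures.
From mathcomp Require Import all_boot all_order all_algebra.
From mathcomp Require Import mpoly.

Set Implicit Arguments.
Unset Strict Implicit.
Unset Printing Implicit Defensive.

Import Order.TTheory GRing.Theory Num.Theory.

Local Open Scope ring_scope.

(* The projective line over K, by normalized homogeneous coordinates:         *)
(* [Some a] is (a : 1) and [None] is (1 : 0).  Equality of points is therefore*)
(* Leibniz equality (see [P1_unique] below).                                  *)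
Definition P1 (K : fieldType) : Type := option K.

Notation P1n K n := {ffun 'I_n -> P1 K}.

Definition xcoord (K : fieldType) (p : P1 K) : K :=
  if p is Some a then a else 1.
Definition ycoord (K : fieldType) (p : P1 K) : K :=
  if p is Some _ then 1 else 0.

Lemma P1_unique (K : fieldType) (a b : K) :
  (a, b) != (0, 0) -> exists! p : P1 K, a * ycoord p = b * xcoord p.
Proof.
rewrite xpair_eqE negb_and; have [->|b0] := eqVneq b 0 => /=.
  rewrite orbF => a0; exists None; split=> [|[c|]] //=.
    by rewrite mulr0 mul0r.
  by rewrite mulr1 mul0r => /eqP; rewrite (negPf a0).
move=> _; exists (Some (a / b)); split=> [|[c|]] //=.
- by rewrite mulr1 mulrC divfK.
- by rewrite mulr1 => ->; rewrite mulrAC divff // mul1r.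
- by rewrite mulr0 mulr1 => /esym/eqP; rewrite (negPf b0).
Qed.

(* In {mpoly K[n + n]} the variable x_i is 'X_(lshift n i) and y_i is         *)
(* 'X_(rshift n i).                                                           *)
Definition mnm_multideg n (d : {ffun 'I_n -> nat}) (m : 'X_{1..n + n}) : bool :=
  [forall i, m (lshift n i) + m (rshift n i) == d i]%N.

Definition multihomog (K : fieldType) n (d : {ffun 'I_n -> nat}) :
    {pred {mpoly K[n + n]}} :=
  fun F => all (mnm_multideg d) (msupp F).

Arguments multihomog K {n} d.

Lemma multihomogP (K : fieldType) n (d : {ffun 'I_n -> nat})
    (F : {mpoly K[n + n]}) :
  reflect (forall m, ~~ mnm_multideg d m -> F@_m = 0) (F \in multihomog K d).
Proof.
apply: (iffP allP) => [dF m|dF m].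
  by apply: contraNeq; rewrite -mcoeff_msupp => /dF.
by rewrite mcoeff_msupp; apply: contraNT => /dF ->.
Qed.

Lemma multihomog_submod_closed (K : fieldType) n (d : {ffun 'I_n -> nat}) :
  submod_closed (multihomog K d).
Proof.
split=> [|c F G /multihomogP dF /multihomogP dG].
  by apply/multihomogP => m _; rewrite mcoeff0.
by apply/multihomogP => m nm; rewrite mcoeffD mcoeffZ dF // dG // mulr0 addr0.
Qed.

HB.instance Definition _ (K : fieldType) n (d : {ffun 'I_n -> nat}) :=
  GRing.isSubmodClosed.Build K {mpoly K[n + n]} (multihomog K d)
    (multihomog_submod_closed K d).

Record mform (K : fieldType) n (d : {ffun 'I_n -> nat}) := MForm {
  mpoly_of_mform :> {mpoly K[n + n]};
  _ : mpoly_of_mform \in multihomog K d }.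

Arguments mform K {n} d.

Section MFormVector.
Context (K : fieldType) (n : nat) (d : {ffun 'I_n -> nat}).

HB.instance Definition _ := [isSub for @mpoly_of_mform K n d].
HB.instance Definition _ := [Choice of mform K d by <:].
HB.instance Definition _ := [SubChoice_isSubLmodule of mform K d by <:].

Lemma mpoly_of_mform_is_linear : linear (@mpoly_of_mform K n d).
Proof. by []. Qed.

HB.instance Definition _ :=
  GRing.isLinear.Build K (mform K d) {mpoly K[n + n]} _ (@mpoly_of_mform K n d)
    mpoly_of_mform_is_linear.

Definition mform_mnms : {set 'X_{1..(n + n) < (\sum_i d i)%N.+1}} :=
  [set m | mnm_multideg d (bmnm m)].

Lemma mnm_multideg_mdeg (m : 'X_{1..n + n}) :
  mnm_multideg d m -> mdeg m = (\sum_i d i)%N.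
Proof.
move=> /forallP dm; rewrite mdegE big_split_ord /= -big_split /=.
by apply: eq_bigr => i _; rewrite (eqP (dm i)).
Qed.

Lemma mform_vecaxiom : vector_axiom #|mform_mnms| (mform K d).
Proof.
pose M (i : 'I_#|mform_mnms|) : 'X_{1..n + n} := enum_val i.
have M_inj : injective M by move=> i j /val_inj/enum_val_inj.
have dM i : mnm_multideg d (M i) by have := enum_valP i; rewrite inE.
have M_surj m : mnm_multideg d m -> exists i, m = M i.
  move=> dm; have lem : (mdeg m < (\sum_i d i).+1)%N.
    by rewrite (mnm_multideg_mdeg dm).
  have inm : BMultinom lem \in mform_mnms by rewrite inE.
  by exists (enum_rank_in inm (BMultinom lem)); rewrite /M enum_rankK_in.
pose f (F : mform K d) : 'rV[K]_#|mform_mnms| :=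
  \row_i (mpoly_of_mform F)@_(M i).
pose g (v : 'rV[K]_#|mform_mnms|) : {mpoly K[n + n]} :=
  \sum_i v 0 i *: 'X_[M i].
have cg v i : (g v)@_(M i) = v 0 i.
  rewrite /g raddf_sum (bigD1 i) //= mcoeffZ mcoeffX eqxx mulr1.
  rewrite -[RHS]addr0; congr (_ + _); apply: big1 => j ji.
  by rewrite mcoeffZ mcoeffX (inj_eq M_inj) (negPf ji) mulr0.
have dg v : g v \in multihomog K d.
  apply/multihomogP => m nm; rewrite /g raddf_sum big1 // => i _ /=.
  rewrite mcoeffZ mcoeffX; case: eqP => [im|_]; last by rewrite mulr0.
  by rewrite -im dM in nm.
exists f => [c F G|]; first by apply/rowP => i; rewrite !mxE mcoeffD mcoeffZ.
exists (fun v => MForm (dg v)) => [F|v]; last by apply/rowP => i; rewrite mxE cg.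
apply/val_inj/mpolyP => m /=; have [dm|ndm] := boolP (mnm_multideg d m).
  by have [i ->] := M_surj _ dm; rewrite cg mxE.
by rewrite (multihomogP _ _ (dg _)) // (multihomogP _ _ (valP F)).
Qed.

HB.instance Definition _ := Lmodule_hasFinDim.Build K (mform K d) mform_vecaxiom.

End MFormVector.

(* Local parametrization of (P^1)^n at p by t_1, ..., t_n, sending t = 0 to p:*)
(* (x_i, y_i) is (a + t_i, 1) if p_i = (a : 1) and (1, t_i) if p_i = (1 : 0). *)
Definition local_chart (K : fieldType) n (p : P1n K n) :
    (n + n).-tuple {mpoly K[n]} :=
  [tuple match split j with
         | inl i => if p i is Some a then a%:MP + 'X_i else 1
         | inr i => if p i is Some _ then 1 else 'X_i
         end | j < n + n].

Definition local_eq (K : fieldType) n (p : P1n K n) (F : {mpoly K[n + n]}) :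
    {mpoly K[n]} :=
  F \mPo local_chart p.

Definition mult_ge (K : fieldType) n (p : P1n K n) (mu : nat)
    (F : {mpoly K[n + n]}) : bool :=
  [forall m : 'X_{1..n < mu}, (local_eq p F)@_m == 0].

Record linsys (K : fieldType) (n : nat) := LinSys {
  lsdeg : {ffun 'I_n -> nat};
  lsmult : seq (P1n K n * nat) }.

Definition local_coef (K : fieldType) n (d : {ffun 'I_n -> nat}) (p : P1n K n)
    (m : 'X_{1..n}) (F : mform K d) : K^o :=
  (local_eq p F)@_m.

Lemma local_coef_is_linear (K : fieldType) n (d : {ffun 'I_n -> nat})
    (p : P1n K n) (m : 'X_{1..n}) : linear (@local_coef K n d p m).
Proof.
by move=> c F G; rewrite /local_coef /local_eq /= comp_mpolyD comp_mpolyZ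
  mcoeffD mcoeffZ.
Qed.

HB.instance Definition _ (K : fieldType) n (d : {ffun 'I_n -> nat})
    (p : P1n K n) (m : 'X_{1..n}) :=
  GRing.isLinear.Build K (mform K d) K^o _ (@local_coef K n d p m)
    (@local_coef_is_linear K n d p m).

Definition V (K : fieldType) n (M : linsys K n) : {vspace mform K (lsdeg M)} :=
  (\bigcap_(pm <- lsmult M) \bigcap_(m : 'X_{1..n < pm.2})
     lker (linfun (@local_coef K n (lsdeg M) pm.1 m)))%VS.

Lemma mem_bigcapv (K : fieldType) (vT : vectType K) (I : Type) (r : seq I)
    (U : I -> {vspace vT}) (v : vT) :
  (v \in (\bigcap_(i <- r) U i)%VS) = all (fun i => v \in U i) r.
Proof.
by elim: r => [|i r IH]; rewrite ?big_nil ?memvf // big_cons memv_cap IH.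
Qed.

Lemma memV (K : fieldType) n (M : linsys K n) (F : mform K (lsdeg M)) :
  (F \in V M) = all (fun pm => mult_ge pm.1 pm.2 F) (lsmult M).
Proof.
rewrite /V mem_bigcapv; apply: eq_all => pm; rewrite mem_bigcapv.
have lkerE (m : 'X_{1..n}) :
    (F \in lker (linfun (@local_coef K n (lsdeg M) pm.1 m)))
    = ((local_eq pm.1 F)@_m == 0).
  by rewrite memv_ker lfunE.
apply/allP/forallP => [H m|H m _]; last by rewrite lkerE.
by rewrite -lkerE H // mem_index_enum.
Qed.

Definition dim (K : fieldType) n (M : linsys K n) : int := (\dim (V M))%:Z - 1.

Definition very_general (K : fieldType) n r (q : r.-tuple (P1n K n)) : Prop :=
  uniq q /\
  forall (d : {ffun 'I_n -> nat}) (m : r.-tuple nat) (p : r.-tuple (P1n K n)),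
    uniq p -> (\dim (V (LinSys d (zip q m))) <= \dim (V (LinSys d (zip p m))))%N.

Definition S_ n (d : {ffun 'I_n -> nat}) (I : {set 'I_n}) : nat :=
  (1 + #|I| + \sum_(i in I) d i)%N.

Definition fdim (K : fieldType) n (M : linsys K n) : int :=
  (\prod_i (lsdeg M i).+1)%N%:Z
  - \sum_(pm <- lsmult M) \sum_(I : {set 'I_n} | (S_ (lsdeg M) I <= pm.2)%N)
      (-1) ^+ #|I| * 'C(pm.2 - S_ (lsdeg M) I + n, n)%:Z
  - 1.

Definition efdim (K : fieldType) n (M : linsys K n) : int :=
  Num.max (-1) (fdim M).

Definition fiber_special (K : fieldType) n (M : linsys K n) : bool :=
  efdim M < dim M.

Definition set_last n (d : {ffun 'I_n.+1 -> nat}) (e : nat) :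
    {ffun 'I_n.+1 -> nat} :=
  [ffun i => if i == ord_max then e else d i].

(* Main.v *)
Require Import Defs.
From HB Require Import structures.
From mathcomp Require Import all_boot all_order all_algebra.
From mathcomp Require Import mpoly ring zify.

Set Implicit Arguments.
Unset Strict Implicit.
Unset Printing Implicit Defensive.

Import Order.TTheory GRing.Theory Num.Theory.

Local Open Scope ring_scope.

(** The heart of the matter is the inequality
    [\dim V(L) <= \dim V(L1) + \dim V(L2)] for very general points, proved in
    [degeneration_bound] by moving the first [s] points in the last factor.

    Choose two points [u] and [u + 1] of the projective line distinct from the
    last coordinates of all the [q_j], cut out by the linear forms
    [l0 = x - u y] and [l1 = x - (u + 1) y], and put [e = d_n - k], where [d_n] is the last degree.  A form of
    degree [d_n = k + e] in the last pair of variables can be written as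
    [P l1^(e+1) + Q l0^k] with [P] of degree [k - 1] and [Q] of degree [e]:
    every monomial of degree [k + e] in [l0] and [l1] is divisible by one of
    the two powers ([split_last]).  Thus [P] and [Q] have the multidegrees of
    [L1] and [L2].

    Let [h_t] be the transformation multiplying [l0] by [t^2] and fixing [l1].
    For [t != 0] it sends the first [s] points to [h_t q_j], and as [t] tends to
    0 these approach [l0 = 0].  Parametrize the forms of multidegree [d] by
    pairs [(P, Q)] through [t (P o h_t^-1) l1^(e+1) + Q l0^k], where the inverse
    is rescaled to be polynomial in [t] ([far_family], surjective by
    [far_form_surj]).  Pulled back by [h_t] this is, up to a power of [t], the
    form [P l1^(e+1) + t (Q o h_t) l0^k] ([near_family]).  The conditions at the
    moved points are therefore conditions on the near family at the original
    points.  All conditions are polynomial in [t], and at [t = 0] they decouple: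
    since [l0] and [l1] do not vanish at the points, they say that [P] lies in
    [V(L1)] and [Q] in [V(L2)].  The dimension of the common kernel of a
    polynomial family of functionals can only jump up at a special parameter
    ([semicontinuity]), so for a suitable [t] the system with multiplicities at
    the moved points has dimension at most [\dim V(L1) + \dim V(L2)], and the
    very general points do at least as well.

    The bounds on the multiplicities enter through the fiber dimension: they
    exclude from the correction sum every [I] with the last index, for [L] as
    well as for [L1] and [L2], and the other terms do not involve the last
    degree.  Hence [fdim + 1] is additive ([fdim_additive]).  As
    [fdim L1 + 1] and [fdim L2 + 1] do not have opposite signs, their positive
    parts add up to the positive part of the sum, which is the conclusion. *)

(** * Polynomial families of functionals and semicontinuity *)

Definition polyfun (K : fieldType) (f : K -> K) : Prop :=
  exists p : {poly K}, forall t, f t = p.[t].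

Lemma eq_polyfun (K : fieldType) (f g : K -> K) :
  f =1 g -> polyfun f -> polyfun g.
Proof. by move=> fg [p fp]; exists p => t; rewrite -fg. Qed.

Lemma polyfunC (K : fieldType) (c : K) : polyfun (fun=> c).
Proof. by exists c%:P => t; rewrite hornerC. Qed.

Lemma polyfun_id (K : fieldType) : polyfun (@id K).
Proof. by exists 'X => t; rewrite hornerX. Qed.

Lemma polyfunD (K : fieldType) (f g : K -> K) :
  polyfun f -> polyfun g -> polyfun (fun t => f t + g t).
Proof. by move=> [p fp] [q gq]; exists (p + q) => t; rewrite hornerD fp gq. Qed.

Lemma polyfunM (K : fieldType) (f g : K -> K) :
  polyfun f -> polyfun g -> polyfun (fun t => f t * g t).
Proof. by move=> [p fp] [q gq]; exists (p * q) => t; rewrite hornerM fp gq. Qed.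

Lemma polyfun_sum (K : fieldType) (I : Type) (r : seq I) (P : pred I)
    (f : I -> K -> K) :
  (forall i, polyfun (f i)) -> polyfun (fun t => \sum_(i <- r | P i) f i t).
Proof.
move=> pf; elim: r => [|i r IH].
  by apply: eq_polyfun (polyfunC 0) => t; rewrite big_nil.
case Pi: (P i); last by apply: eq_polyfun IH => t; rewrite big_cons Pi.
by apply: eq_polyfun (polyfunD (pf i) IH) => t; rewrite big_cons Pi.
Qed.

(** Choose a basis of a complement of [U0]: the functionals at [t = 0] separate
    its span, so some square matrix with entries polynomial in t,
    built from the values on these vectors, is the identity at [t = 0].  Wherever
    its determinant does not vanish, the common kernel still meets the
    complement trivially. *)
Lemma semicontinuity (K : fieldType) (vT : vectType K) (I : finType)
    (phi : I -> K -> vT -> K) (U0 : {vspace vT}) :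
  (forall i t c v w, phi i t (c *: v + w) = c * phi i t v + phi i t w) ->
  (forall i v, polyfun (fun t => phi i t v)) ->
  (forall v, (forall i, phi i 0 v = 0) -> v \in U0) ->
  exists2 g : {poly K}, g != 0 &
    forall t, g.[t] != 0 -> forall X : {vspace vT},
      (forall v, v \in X -> forall i, phi i t v = 0) -> (\dim X <= \dim U0)%N.
Proof.
move=> lin pol U0P; pose C := (U0^C)%VS.
have [b bC] : exists b : (\dim C).-tuple vT, basis_of C b.
  by exists (vbasis C); apply: vbasisP.
have phi0 i t : phi i t 0 = 0.
  have := lin i t 0 0 0; rewrite scaler0 addr0 mul0r add0r => ->.
  by have := lin i t 1 0 0; rewrite scale1r addr0 mul1r => /esym/eqP;
     rewrite -subr_eq0 addrK => /eqP.
have phi_sum i t (w : 'rV[K]_(\dim C)) :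
    phi i t (\sum_j w 0 j *: b`_j) = \sum_j w 0 j * phi i t b`_j.
  elim/big_rec2: _ => [|j x y _ <-]; first exact: phi0.
  by rewrite lin.
pose B t : 'M[K]_(\dim C, #|I|) := \matrix_(j, i) phi (enum_val i) t b`_j.
have BE t (w : 'rV[K]_(\dim C)) i :
    (w *m B t) 0 (enum_rank i) = phi i t (\sum_j w 0 j *: b`_j).
  rewrite mxE phi_sum; apply: eq_bigr => j _.
  by rewrite mxE enum_rankK.
have combC (w : 'rV[K]_(\dim C)) : \sum_j w 0 j *: b`_j \in C.
  apply: rpred_sum => j _; apply: rpredZ; apply: (basis_mem bC).
  by rewrite mem_nth // size_tuple.
have capC v : v \in C -> v \in U0 -> v = 0.
  move=> vC vU; apply/eqP; rewrite -memv0 -(capv_compl U0).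
  by rewrite memv_cap vU.
have comb0 (w : 'rV[K]_(\dim C)) : \sum_j w 0 j *: b`_j = 0 -> w = 0.
  move=> w0; apply/rowP => j; rewrite mxE.
  have /freeP/(_ (fun j => w 0 j)) := basis_free bC.
  by apply.
have B0 : row_free (B 0).
  rewrite -kermx_eq0; apply/rowV0P => w /sub_kermxP wB.
  apply: comb0; apply: capC => //; apply: U0P => i.
  by rewrite -BE wB mxE.
pose R := pinvmx (B 0).
have BR0 : B 0 *m R = 1%:M by rewrite mulmxVp.
have /fin_all_exists[p pE] (ji : 'I_(\dim C) * 'I_(\dim C)) :
    exists p : {poly K}, forall t, (B t *m R) ji.1 ji.2 = p.[t].
  suff [p pE] : polyfun (fun t => \sum_i B t ji.1 i * R i ji.2).
    by exists p => t; rewrite mxE.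
  apply: polyfun_sum => i; apply: polyfunM; last exact: polyfunC.
  by apply: eq_polyfun (pol (enum_val i) b`_ji.1) => t; rewrite mxE.
pose M : 'M[{poly K}]_(\dim C) := \matrix_(j, i) p (j, i).
have detM t : (\det M).[t] = \det (B t *m R).
  rewrite -[LHS]/(horner_eval t (\det M)) -det_map_mx; congr (\det _).
  by apply/matrixP => j i; rewrite [LHS]mxE [M _ _]mxE; exact: esym (pE (j, i) t).
exists (\det M).
  apply/eqP => M0; have := detM 0; rewrite M0 horner0 BR0 det1 => /esym/eqP.
  by rewrite oner_eq0.
move=> t gt X XP.
have XC : (X :&: C)%VS = 0%VS.
  apply/eqP; rewrite -subv0; apply/subvP => v; rewrite memv_cap memv0.
  case/andP=> vX vC; pose w := \row_j coord b j v.
  have vE : v = \sum_j w 0 j *: b`_j.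
    rewrite {1}(coord_basis bC vC); apply: eq_bigr => j _; by rewrite mxE.
  have wB : w *m B t = 0.
    by apply/rowP => i; rewrite -(enum_valK i) BE -vE XP // mxE.
  have uB : B t *m R \in unitmx by rewrite unitmxE unitfE -detM.
  have w0 : w = 0.
    by rewrite -(mulmxK uB w) mulmxA wB !mul0mx.
  by rewrite vE w0 big1 // => j _; rewrite mxE scale0r.
have := dimv_sum_cap X C; rewrite XC dimv0 addn0 => XCd.
have : (\dim (X + C) <= \dim {:vT})%N by rewrite dimvS ?subvf.
rewrite XCd -(addv_complf U0) dimv_disjoint_sum ?leq_add2r //.
exact: capv_compl.
Qed.

(** * Substitution, order of vanishing at the origin *)

Lemma comp_mpolyA (K : fieldType) a b c (F : {mpoly K[a]})
    (S : a.-tuple {mpoly K[b]}) (T : b.-tuple {mpoly K[c]}) :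
  (F \mPo S) \mPo T = F \mPo [tuple tnth S i \mPo T | i < a].
Proof.
rewrite [F \mPo S]comp_mpolyEX raddf_sum [RHS]comp_mpolyEX /=.
apply: eq_bigr => m _; rewrite comp_mpolyZ !comp_mpolyX rmorph_prod /=.
by congr (_ *: _); apply: eq_bigr => i _; rewrite rmorphXn tnth_mktuple.
Qed.

Definition mpolyfun (K : fieldType) n (F : K -> {mpoly K[n]}) : Prop :=
  forall m, polyfun (fun t => (F t)@_m).

Lemma mpolyfunC (K : fieldType) n (F : {mpoly K[n]}) : mpolyfun (fun=> F).
Proof. by move=> m; apply: polyfunC. Qed.

Lemma mpolyfunD (K : fieldType) n (F G : K -> {mpoly K[n]}) :
  mpolyfun F -> mpolyfun G -> mpolyfun (fun t => F t + G t).
Proof.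
move=> pF pG m.
by apply: eq_polyfun (polyfunD (pF m) (pG m)) => t; rewrite mcoeffD.
Qed.

Lemma mpolyfunZ (K : fieldType) n (f : K -> K) (F : K -> {mpoly K[n]}) :
  polyfun f -> mpolyfun F -> mpolyfun (fun t => f t *: F t).
Proof.
move=> pf pF m.
by apply: eq_polyfun (polyfunM pf (pF m)) => t; rewrite mcoeffZ.
Qed.

Lemma mpolyfunM (K : fieldType) n (F G : K -> {mpoly K[n]}) :
  mpolyfun F -> mpolyfun G -> mpolyfun (fun t => F t * G t).
Proof.
move=> pF pG m; have mE t := mcoeffM (F t) (G t) m.
apply: eq_polyfun (fun t => esym (mE t)) _.
by apply: polyfun_sum => h; apply: polyfunM.
Qed.

Lemma mpolyfunX (K : fieldType) n (F : K -> {mpoly K[n]}) e :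
  mpolyfun F -> mpolyfun (fun t => F t ^+ e).
Proof.
move=> pF; elim: e => [|e IH] m.
  by apply: eq_polyfun (polyfunC (mcoeff m 1)) => t; rewrite expr0.
by apply: eq_polyfun (mpolyfunM pF IH m) => t; rewrite exprS.
Qed.

Lemma mpolyfun_comp (K : fieldType) a n (F : {mpoly K[a]})
    (T : K -> a.-tuple {mpoly K[n]}) :
  (forall i, mpolyfun (fun t => tnth (T t) i)) -> mpolyfun (fun t => F \mPo T t).
Proof.
move=> pT m.
pose f t M := (F@_M *: \prod_(i < a) tnth (T t) i ^+ M i)@_m.
apply: (@eq_polyfun _ (fun t => \sum_(M <- msupp F) f t M)).
  by move=> t; rewrite comp_mpolyE raddf_sum.
apply: polyfun_sum => M; rewrite /f.
suff pP : mpolyfun (fun t => \prod_(i < a) tnth (T t) i ^+ M i).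
  exact: (mpolyfunZ (polyfunC F@_M) pP m).
elim: (index_enum _) => [|i s IH] k.
  by apply: eq_polyfun (polyfunC (mcoeff k 1)) => t; rewrite big_nil.
by apply: eq_polyfun (mpolyfunM (mpolyfunX (M i) (pT i)) IH k) => t;
  rewrite big_cons.
Qed.

(** [f] lies in the [mu]-th power of the maximal ideal of the origin. *)
Definition ord_ge (K : fieldType) n (mu : nat) (f : {mpoly K[n]}) : Prop :=
  forall m, (mdeg m < mu)%N -> f@_m = 0.

Lemma mult_geP (K : fieldType) n (p : P1n K n) mu (F : {mpoly K[n + n]}) :
  reflect (ord_ge mu (local_eq p F)) (mult_ge p mu F).
Proof.
apply: (iffP forallP) => [H m lm|H m]; last by apply/eqP/H/bmdeg.
exact/eqP/(H (BMultinom lm)).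
Qed.

Lemma ord_ge0 (K : fieldType) n (f : {mpoly K[n]}) : ord_ge 0 f.
Proof. by []. Qed.

Lemma ord_geZ (K : fieldType) n mu (c : K) (f : {mpoly K[n]}) :
  ord_ge mu f -> ord_ge mu (c *: f).
Proof. by move=> of_ m lm; rewrite mcoeffZ of_ // mulr0. Qed.

Lemma ord_ge_sum (K : fieldType) n mu (I : eqType) (r : seq I)
    (f : I -> {mpoly K[n]}) :
  (forall i, i \in r -> ord_ge mu (f i)) -> ord_ge mu (\sum_(i <- r) f i).
Proof.
move=> of_ m lm; rewrite raddf_sum big_seq big1 // => i ir; exact: of_.
Qed.

Lemma ord_geM (K : fieldType) n a b (f g : {mpoly K[n]}) :
  ord_ge a f -> ord_ge b g -> ord_ge (a + b) (f * g).
Proof.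
move=> of_ og m lm; rewrite mcoeffM big1 // => h /eqP hE.
have [lf|gf] := ltnP (mdeg h.1) a; first by rewrite of_ ?mul0r.
have mE : mdeg m = (mdeg h.1 + mdeg h.2)%N by rewrite {1}hE mdegD.
rewrite mE in lm; rewrite og ?mulr0 //.
by rewrite -(ltn_add2l (mdeg h.1)) (leq_trans lm) // leq_add2r.
Qed.

Lemma ord_geX (K : fieldType) n (f : {mpoly K[n]}) e :
  f@_0 = 0 -> ord_ge e (f ^+ e).
Proof.
move=> f0; elim: e => [|e IH]; first exact: ord_ge0.
rewrite exprS -add1n; apply: ord_geM IH => m.
by rewrite ltnS leqn0 mdeg_eq0 => /eqP ->.
Qed.

Lemma ord_ge_prod (K : fieldType) n (I : Type) (r : seq I) (e : I -> nat)
    (f : I -> {mpoly K[n]}) :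
  (forall i, ord_ge (e i) (f i)) ->
  ord_ge (\sum_(i <- r) e i) (\prod_(i <- r) f i).
Proof.
move=> of_; elim: r => [|i r IH]; first by rewrite big_nil; apply: ord_ge0.
by rewrite !big_cons; apply: ord_geM.
Qed.

(** The lowest-degree part of [f * g] is [g@_0] times that of [f], so a factor
    that is a unit at the origin does not contribute to the order. *)
Lemma ord_ge_unitr (K : fieldType) n mu (f g : {mpoly K[n]}) :
  g@_0 != 0 -> ord_ge mu (f * g) -> ord_ge mu f.
Proof.
move=> g0; elim: mu => [|mu IH] ofg; first exact: ord_ge0.
have {}IH : ord_ge mu f by apply: IH => m lm; apply: ofg; apply: ltnW.
move=> m lm; have := ofg m lm; rewrite mcoeffM.
have lt0 : (mdeg (0%MM : 'X_{1..n}) < (mdeg m).+1)%N by rewrite mdeg0.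
rewrite (bigD1 (BMultinom (leqnn (mdeg m).+1), BMultinom lt0)) /=;
  last by rewrite addm0.
rewrite big1 ?addr0 => [/eqP|[h1 h2] /andP[/eqP hE hn]].
  by rewrite mulf_eq0 (negPf g0) orbF => /eqP.
rewrite IH ?mul0r //=; rewrite /= in hE hn.
have : mdeg m = (mdeg h1 + mdeg h2)%N by rewrite {1}hE mdegD.
have [h20|h2n] := eqVneq (bmnm h2) 0%MM.
  case/negP: hn; rewrite xpair_eqE; apply/andP.
  split; apply/eqP/val_inj => //=.
  by rewrite h20 addm0 in hE; exact: esym hE.
rewrite -mdeg_eq0 -lt0n in h2n.
move=> mE; rewrite ltnS in lm; apply: leq_trans lm.
by rewrite [X in (_ < X)%N]mE -addn1 leq_add2l.
Qed.

(** * Multihomogeneous polynomials and multiplicity in a chart *)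

Definition unit_deg n (i : 'I_n) : {ffun 'I_n -> nat} := [ffun j => (j == i) : nat].

Lemma multihomogXm (K : fieldType) n (d : {ffun 'I_n -> nat}) m :
  mnm_multideg d m -> 'X_[m] \in multihomog K d.
Proof. by move=> dm; apply/allP => m'; rewrite msuppX inE => /eqP ->. Qed.

Lemma multihomog_X (K : fieldType) n (i : 'I_n) :
  ('X_(lshift n i) : {mpoly K[n + n]}) \in multihomog K (unit_deg i)
  /\ ('X_(rshift n i) : {mpoly K[n + n]}) \in multihomog K (unit_deg i).
Proof.
split; apply: multihomogXm; apply/forallP => j; rewrite !mnm1E ffunE.
  by rewrite eq_lshift eq_lrshift addn0 (eq_sym i).
by rewrite eq_rlshift eq_rshift add0n (eq_sym i).
Qed.

Lemma multihomog1 (K : fieldType) n (d : {ffun 'I_n -> nat}) :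
  (forall i, d i = 0%N) -> 1 \in multihomog K d.
Proof.
move=> d0; rewrite -mpolyX0; apply: multihomogXm; apply/forallP => i.
by rewrite !mnm0E d0.
Qed.

Lemma multihomog_mulr (K : fieldType) n (a b d : {ffun 'I_n -> nat})
    (F G : {mpoly K[n + n]}) :
  F \in multihomog K a -> G \in multihomog K b ->
  (forall i, d i = (a i + b i)%N) -> F * G \in multihomog K d.
Proof.
move=> /allP aF /allP bG dE; apply/allP => m /msuppM_le /allpairsP[[m1 m2] /=].
case=> /aF /forallP m1a /bG /forallP m2b ->; apply/forallP => i.
by rewrite !mnmDE addnACA (eqP (m1a i)) (eqP (m2b i)) dE.
Qed.

Lemma multihomog_exp (K : fieldType) n (a d : {ffun 'I_n -> nat}) e
    (F : {mpoly K[n + n]}) :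
  F \in multihomog K a -> (forall i, d i = (e * a i)%N) ->
  F ^+ e \in multihomog K d.
Proof.
move=> aF; elim: e d => [|e IH] d dE.
  by rewrite expr0; apply: multihomog1 => i; rewrite dE.
rewrite exprS; apply: (multihomog_mulr (b := [ffun i => (e * a i)%N]) aF).
  by apply: IH => i; rewrite ffunE.
by move=> i; rewrite dE ffunE mulSn.
Qed.

Lemma multihomog_prod (K : fieldType) n (I : Type) (r : seq I)
    (a : I -> {ffun 'I_n -> nat}) (d : {ffun 'I_n -> nat})
    (F : I -> {mpoly K[n + n]}) :
  (forall i, F i \in multihomog K (a i)) ->
  (forall j, d j = (\sum_(i <- r) a i j)%N) ->
  \prod_(i <- r) F i \in multihomog K d.
Proof.
move=> aF; elim: r d => [|i r IH] d dE.
  by rewrite big_nil; apply: multihomog1 => j; rewrite dE big_nil.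
rewrite big_cons.
apply: (multihomog_mulr (b := [ffun j => (\sum_(i <- r) a i j)%N]) (aF i)).
  by apply: IH => j; rewrite ffunE.
by move=> j; rewrite dE ffunE big_cons.
Qed.

Lemma multihomog_comp (K : fieldType) n (d : {ffun 'I_n -> nat})
    (F : {mpoly K[n + n]}) (T : (n + n).-tuple {mpoly K[n + n]}) :
  F \in multihomog K d ->
  (forall i, tnth T (lshift n i) \in multihomog K (unit_deg i)) ->
  (forall i, tnth T (rshift n i) \in multihomog K (unit_deg i)) ->
  F \mPo T \in multihomog K d.
Proof.
move=> /allP dF Tx Ty; rewrite comp_mpolyE big_seq; apply: rpred_sum => M MF.
apply: rpredZ; rewrite big_split_ord /= -big_split /=.
apply: (multihomog_prod (a := fun i => [ffun j => (d i * unit_deg i j)%N])).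
  move=> i; have /forallP/(_ i)/eqP Mi := dF M MF.
  have ex e (X : {mpoly K[n + n]}) : X \in multihomog K (unit_deg i) ->
      X ^+ e \in multihomog K [ffun j => (e * unit_deg i j)%N].
    by move=> dX; apply: (multihomog_exp dX) => j; rewrite ffunE.
  apply: (multihomog_mulr (ex _ _ (Tx i)) (ex _ _ (Ty i))) => j.
  by rewrite !ffunE -mulnDl Mi.
move=> j; rewrite (bigD1 j) //= big1 ?addn0 => [|i ij].
  by rewrite !ffunE eqxx muln1.
by rewrite !ffunE eq_sym (negPf ij) muln0.
Qed.

Definition pair_tuple (T : Type) n (f g : 'I_n -> T) : (n + n).-tuple T :=
  [tuple match split j with inl i => f i | inr i => g i end | j < n + n].

Lemma tnth_pairl (T : Type) n (f g : 'I_n -> T) i :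
  tnth (pair_tuple f g) (lshift n i) = f i.
Proof. by rewrite tnth_mktuple (unsplitK (inl i)). Qed.

Lemma tnth_pairr (T : Type) n (f g : 'I_n -> T) i :
  tnth (pair_tuple f g) (rshift n i) = g i.
Proof. by rewrite tnth_mktuple (unsplitK (inr i)). Qed.

Lemma eq_pair_tuple (T : Type) n (t : (n + n).-tuple T) (f g : 'I_n -> T) :
  (forall i, tnth t (lshift n i) = f i) ->
  (forall i, tnth t (rshift n i) = g i) -> t = pair_tuple f g.
Proof.
move=> tf tg; apply: eq_from_tnth => j; rewrite -(splitK j).
by case: (split j) => i /=; rewrite ?tnth_pairl ?tnth_pairr.
Qed.

Lemma local_chartl (K : fieldType) n (p : P1n K n) i :
  tnth (local_chart p) (lshift n i) = if p i is Some a then a%:MP + 'X_i else 1.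
Proof. by rewrite tnth_mktuple (unsplitK (inl i)). Qed.

Lemma local_chartr (K : fieldType) n (p : P1n K n) i :
  tnth (local_chart p) (rshift n i) = if p i is Some _ then 1 else 'X_i.
Proof. by rewrite tnth_mktuple (unsplitK (inr i)). Qed.

Lemma comp_mpolyXi (K : fieldType) a b (i : 'I_a) (T : a.-tuple {mpoly K[b]}) :
  'X_i \mPo T = tnth T i.
Proof. by rewrite comp_mpolyXU -tnth_nth. Qed.

(** The multiplicity at [p] is seen by any map whose value at the origin is
    [p], whatever the homogeneous coordinates chosen for it.  After the linear
    change of coordinates [lam], which moves [p] to the point with all first
    coordinates zero, the chart at [p] only sets the second coordinates to 1; by
    multihomogeneity this loses no coefficient, so every monomial of [G] has
    degree at least [mu] in the first coordinates.  Under [chi] these become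
    polynomials without constant term. *)
Lemma ord_ge_comp (K : fieldType) n (d : {ffun 'I_n -> nat}) (p : P1n K n) mu
    (F : {mpoly K[n + n]}) (chi : (n + n).-tuple {mpoly K[n]}) :
  F \in multihomog K d -> mult_ge p mu F ->
  (forall i, (tnth chi (lshift n i))@_0 * ycoord (p i)
             = (tnth chi (rshift n i))@_0 * xcoord (p i)) ->
  ord_ge mu (F \mPo chi).
Proof.
move=> dF /mult_geP pF chip.
pose U i : {mpoly K[n + n]} := 'X_(lshift n i).
pose W i : {mpoly K[n + n]} := 'X_(rshift n i).
(* The coordinates of [p] become (0 : 1) in each factor. *)
pose lam := pair_tuple (fun i => if p i is Some a then a *: W i + U i else W i)
                       (fun i => if p i is Some _ then W i else U i).
have dU i : U i \in multihomog K (unit_deg i) by case: (multihomog_X K i).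
have dW i : W i \in multihomog K (unit_deg i) by case: (multihomog_X K i).
pose G := F \mPo lam.
have dG : G \in multihomog K d.
  apply: multihomog_comp => // i; rewrite ?tnth_pairl ?tnth_pairr.
    by case: (p i) => [a|//]; apply: rpredD => //; apply: rpredZ.
  by case: (p i).
pose res (M : 'X_{1..n + n}) := [multinom M (lshift n i) | i < n].
have locE : local_eq p F = \sum_(M <- msupp G) G@_M *: 'X_[res M].
  transitivity (G \mPo pair_tuple (fun i => 'X_i : {mpoly K[n]}) (fun=> 1)).
    rewrite comp_mpolyA; congr (F \mPo _); symmetry.
    rewrite [local_chart p](eq_pair_tuple (local_chartl p) (local_chartr p)).
    apply: eq_pair_tuple => i; rewrite tnth_mktuple ?tnth_pairl ?tnth_pairr.
      case: (p i) => [a|].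
        by rewrite comp_mpolyD comp_mpolyZ !comp_mpolyXi tnth_pairl tnth_pairr
                   alg_mpolyC.
      by rewrite comp_mpolyXi tnth_pairr.
    by case: (p i) => [a|]; rewrite comp_mpolyXi ?tnth_pairl ?tnth_pairr.
  rewrite comp_mpolyE; apply: eq_bigr => M _; congr (_ *: _).
  rewrite big_split_ord /= [X in _ * X]big1 ?mulr1 => [|i _]; last first.
    by rewrite tnth_pairr expr1n.
  rewrite [RHS]mpolyXE_id; apply: eq_bigr => i _.
  by rewrite tnth_pairl mnmE.
have res_deg M : M \in msupp G -> (mu <= mdeg (res M))%N.
  move=> MG; rewrite leqNgt; apply/negP => lt; have := pF _ lt.
  rewrite locE raddf_sum (bigD1_seq M) //= mcoeffZ mcoeffX eqxx mulr1.
  rewrite big_seq_cond big1 ?addr0 => [G0|M' /andP[M'G M'M]].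
    by move: MG; rewrite mcoeff_msupp G0 eqxx.
  rewrite mcoeffZ mcoeffX; case: eqP => [rE|_]; last by rewrite mulr0.
  case/eqP: M'M; apply/mnmP => j.
  have rEi i : M' (lshift n i) = M (lshift n i).
    by have := congr1 (fun m : 'X_{1..n} => m i) rE; rewrite !mnmE.
  rewrite -(splitK j); case: (split j) => i //=.
  have /allP dGa := dG; have /forallP/(_ i)/eqP := dGa _ MG.
  have /forallP/(_ i)/eqP := dGa _ M'G; rewrite rEi => <- /addnI.
  by [].
pose X i := tnth chi (lshift n i); pose Y i := tnth chi (rshift n i).
(* [lin] and [unt] are [chi] read in the coordinates given by [lam]. *)
pose lin i := if p i is Some a then X i - a *: Y i else Y i.
pose unt i := if p i is Some _ then Y i else X i.
have -> : F \mPo chi = G \mPo pair_tuple lin unt.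
  rewrite comp_mpolyA; congr (F \mPo _).
  rewrite (eq_pair_tuple (fun=> erefl) (fun=> erefl) : chi = pair_tuple X Y).
  symmetry; apply: eq_pair_tuple => i.
    rewrite tnth_mktuple tnth_pairl /lin /unt; case pi: (p i) => [a|].
      rewrite comp_mpolyD comp_mpolyZ !comp_mpolyXi tnth_pairl tnth_pairr pi.
      by rewrite addrC subrK.
    by rewrite comp_mpolyXi tnth_pairr pi.
  rewrite tnth_mktuple tnth_pairr /lin /unt; case pi: (p i) => [a|].
    by rewrite comp_mpolyXi tnth_pairr pi.
  by rewrite comp_mpolyXi tnth_pairl pi.
have lin0 i : (lin i)@_0 = 0.
  have := chip i; rewrite /lin /xcoord /ycoord -/(X i) -/(Y i).
  case: (p i) => [a|]; last by rewrite mulr0 mulr1.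
  by rewrite mulr1 mcoeffB mcoeffZ => ->; rewrite mulrC subrr.
rewrite comp_mpolyE; apply: ord_ge_sum => M MG; apply: ord_geZ.
rewrite big_split_ord /= => m lm.
apply: (ord_geM (a := mdeg (res M)) (b := 0)).
- rewrite mdegE; apply: ord_ge_prod => i.
  by rewrite tnth_pairl mnmE; apply: ord_geX.
- exact: ord_ge0.
- by rewrite addn0 (leq_trans lm) // res_deg.
Qed.

(** * Linear substitutions in the last pair of variables *)

Section LastPair.
Variables (K : fieldType) (n : nat).
Implicit Types (F X Y : {mpoly K[n.+1 + n.+1]}) (u a b c : K).

Definition last_x : {mpoly K[n.+1 + n.+1]} := 'X_(lshift n.+1 ord_max).
Definition last_y : {mpoly K[n.+1 + n.+1]} := 'X_(rshift n.+1 ord_max).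

Definition last_subst X Y : (n.+1 + n.+1).-tuple {mpoly K[n.+1 + n.+1]} :=
  pair_tuple (fun i => if i == ord_max then X else 'X_(lshift n.+1 i))
             (fun i => if i == ord_max then Y else 'X_(rshift n.+1 i)).

Lemma last_substx X Y : last_x \mPo last_subst X Y = X.
Proof. by rewrite comp_mpolyXi tnth_pairl eqxx. Qed.

Lemma last_substy X Y : last_y \mPo last_subst X Y = Y.
Proof. by rewrite comp_mpolyXi tnth_pairr eqxx. Qed.

Lemma last_subst_id F : F \mPo last_subst last_x last_y = F.
Proof.
rewrite -[RHS]comp_mpoly_id; congr (F \mPo _); symmetry.
by apply: eq_pair_tuple => i; rewrite tnth_mktuple; case: eqP => [->|].
Qed.

Lemma last_subst_comp F X Y X' Y' :
  (F \mPo last_subst X Y) \mPo last_subst X' Y'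
  = F \mPo last_subst (X \mPo last_subst X' Y') (Y \mPo last_subst X' Y').
Proof.
rewrite comp_mpolyA; congr (F \mPo _); apply: eq_pair_tuple => i.
  rewrite tnth_mktuple tnth_pairl; case: eqVneq => // /negPf ni.
  by rewrite comp_mpolyXi tnth_pairl ni.
rewrite tnth_mktuple tnth_pairr; case: eqVneq => // /negPf ni.
by rewrite comp_mpolyXi tnth_pairr ni.
Qed.

Lemma multihomog_last_subst d F X Y :
  F \in multihomog K d -> X \in multihomog K (unit_deg ord_max) ->
  Y \in multihomog K (unit_deg ord_max) ->
  F \mPo last_subst X Y \in multihomog K d.
Proof.
move=> dF dX dY; apply: multihomog_comp => // i.
  by rewrite tnth_pairl; case: eqP => [->//|_]; case: (multihomog_X K i).
by rewrite tnth_pairr; case: eqP => [->//|_]; case: (multihomog_X K i).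
Qed.

(** The equation of the fibre over the point (c : 1) of the last factor. *)
Definition lform c : {mpoly K[n.+1 + n.+1]} := last_x - c *: last_y.

Lemma multihomog_lform c : lform c \in multihomog K (unit_deg ord_max).
Proof.
have [dx dy] := multihomog_X K (ord_max : 'I_n.+1).
by apply: rpredB => //; apply: rpredZ.
Qed.

Lemma multihomog_lformX c e (d : {ffun 'I_n.+1 -> nat}) F :
  F \in multihomog K (set_last d e) ->
  forall f, (e + f = d ord_max)%N -> F * lform c ^+ f \in multihomog K d.
Proof.
move=> dF f efd; have dl := multihomog_lform c.
apply: (multihomog_mulr (b := [ffun i => (f * unit_deg ord_max i)%N]) dF).
  by apply: (multihomog_exp dl) => i; rewrite ffunE.
move=> i; rewrite !ffunE; case: eqP => [->|_]; first by rewrite muln1 efd.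
by rewrite muln0 addn0.
Qed.

(** The linear substitution that scales [lform u] by [a] and [lform (u + 1)] by
    [b]: since [last_y = lform u - lform (u + 1)] and
    [last_x = (u + 1) lform u - u lform (u + 1)], its components are obtained by
    scaling the two forms in these expressions. *)
Definition scale_subst u a b :=
  last_subst (((u + 1) * a) *: lform u - (u * b) *: lform (u + 1))
             (a *: lform u - b *: lform (u + 1)).

Lemma lform_subst c X Y : lform c \mPo last_subst X Y = X - c *: Y.
Proof. by rewrite comp_mpolyB comp_mpolyZ last_substx last_substy. Qed.

Lemma lform_scale0 u a b : lform u \mPo scale_subst u a b = a *: lform u.
Proof. by rewrite lform_subst -!mul_mpolyC; ring. Qed.

Lemma lform_scale1 u a b :
  lform (u + 1) \mPo scale_subst u a b = b *: lform (u + 1).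
Proof. by rewrite lform_subst -!mul_mpolyC; ring. Qed.

Lemma scale_subst11 u F : F \mPo scale_subst u 1 1 = F.
Proof.
have -> : scale_subst u 1 1 = last_subst last_x last_y.
  rewrite /scale_subst !mulr1 !scale1r /lform.
  by congr last_subst; rewrite -!mul_mpolyC; ring.
exact: last_subst_id.
Qed.

Lemma scale_subst_comp u a b a' b' F :
  (F \mPo scale_subst u a b) \mPo scale_subst u a' b'
  = F \mPo scale_subst u (a * a') (b * b').
Proof.
rewrite last_subst_comp !comp_mpolyB !comp_mpolyZ !lform_scale0 !lform_scale1.
by rewrite !scalerA -!mulrA.
Qed.

Lemma multihomog_scale u a b d F :
  F \in multihomog K d -> F \mPo scale_subst u a b \in multihomog K d.
Proof.
move=> dF; have dl := multihomog_lform.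
by apply: multihomog_last_subst => //; apply: rpredB; apply: rpredZ.
Qed.

(** A monomial of degree [d ord_max] in the last pair is divisible by
    [last_x ^ k] or else has degree at least [d ord_max - k + 1] in [last_y]. *)
Lemma split_last_xy (d : {ffun 'I_n.+1 -> nat}) k F :
  (k <= d ord_max)%N -> F \in multihomog K d ->
  exists A B, [/\ A \in multihomog K (set_last d (k - 1)),
    B \in multihomog K (set_last d (d ord_max - k)) &
    F = A * last_y ^+ (d ord_max - k).+1 + B * last_x ^+ k].
Proof.
move=> kd /allP dF; pose e := (d ord_max - k)%N; rewrite [F]mpolyE big_seq.
elim/big_rec: _ => [|M G /dF/forallP dM [A [B [dA dB ->]]]].
  by exists 0, 0; rewrite !mul0r addr0 !rpred0.
have shift (v : 'I_(n.+1 + n.+1)) (c : nat) : (c <= M v)%N ->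
    'X_[M] = 'X_[M - U_(v) *+ c] * ('X_v : {mpoly K[n.+1 + n.+1]}) ^+ c.
  move=> cM; rewrite mpolyXn -mpolyXD submK //.
  apply/mnm_lepP => j; rewrite mulmnE mnm1E.
  by case: eqP => [<-|_]; rewrite /= ?mul1n ?mul0n.
have [kM|Mk] := leqP k (M (lshift n.+1 ord_max)).
  exists A, (F@_M *: 'X_[M - U_(lshift n.+1 ord_max) *+ k] + B); split=> //.
    apply: rpredD => //; apply: rpredZ; apply: multihomogXm; apply/forallP => i.
    rewrite !mnmBE !mulmnE !mnm1E eq_lshift eq_lrshift /= ?mul0n ?muln0 ?subn0 ffunE.
    have /eqP dMi := dM i; rewrite [ord_max == i]eq_sym.
    case: (i =P ord_max) => [ii|_]; last by rewrite /= ?mul0n ?muln0 ?subn0 dMi.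
    by rewrite -ii in kM; rewrite /= ?mul1n addnBAC ?dMi // ii.
  by rewrite mulrDl -scalerAl -shift // [RHS]addrCA.
exists (F@_M *: 'X_[M - U_(rshift n.+1 ord_max) *+ e.+1] + A), B.
have /eqP dMl := dM ord_max.
have eM : (e < M (rshift n.+1 ord_max))%N.
  by rewrite -(ltn_add2l (M (lshift n.+1 ord_max))) dMl /e -(subnKC kd) addKn ltn_add2r.
split=> //.
  apply: rpredD => //; apply: rpredZ; apply: multihomogXm; apply/forallP => i.
  rewrite !mnmBE !mulmnE !mnm1E eq_rlshift eq_rshift /= ?mul0n ?muln0 ?subn0 ffunE.
  have /eqP dMi := dM i; rewrite [ord_max == i]eq_sym.
  case: (i =P ord_max) => [ii|_]; last by rewrite /= ?mul0n ?muln0 ?subn0 dMi.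
  by rewrite /= ?mul1n addnBA ii // dMl /e subnS subKn // subn1.
by rewrite mulrDl -scalerAl -shift // [LHS]addrA.
Qed.

(** The same splitting as in [split_last_xy], in the coordinates [lform u] and
    [lform (u + 1)] of the last factor. *)
Lemma split_last u (d : {ffun 'I_n.+1 -> nat}) k F :
  (k <= d ord_max)%N -> F \in multihomog K d ->
  exists A B, [/\ A \in multihomog K (set_last d (k - 1)),
    B \in multihomog K (set_last d (d ord_max - k)) &
    F = A * lform (u + 1) ^+ (d ord_max - k).+1 + B * lform u ^+ k].
Proof.
move=> kd dF; have [dx dy] := multihomog_X K (ord_max : 'I_n.+1).
have dl := multihomog_lform.
pose G := F \mPo last_subst ((u + 1) *: last_x - u *: last_y) (last_x - last_y).
have dG : G \in multihomog K d.
  apply: multihomog_last_subst => //; apply: rpredB => //; exact: rpredZ.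
have -> : F = G \mPo last_subst (lform u) (lform (u + 1)).
  rewrite last_subst_comp !comp_mpolyB !comp_mpolyZ last_substx last_substy.
  rewrite -[LHS](scale_subst11 u); rewrite /scale_subst.
  by rewrite !mulr1 !scale1r.
have [A [B [dA dB ->]]] := split_last_xy kd dG.
exists (A \mPo last_subst (lform u) (lform (u + 1))).
exists (B \mPo last_subst (lform u) (lform (u + 1))).
split; try exact: multihomog_last_subst.
by rewrite comp_mpolyD !rmorphM !rmorphXn /= last_substx last_substy.
Qed.

End LastPair.

(** * The action on points of the last factor *)

Section Points.
Variable K : fieldType.
Implicit Types (p : P1 K) (u a b c t : K).

(** The value of the form [x - c y] at the normalized coordinates of [p]; only
    its vanishing is intrinsic. *)
Definition lval c p : K := xcoord p - c * ycoord p.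

(** The point (x : y), with an irrelevant value when [x = y = 0]. *)
Definition P1_of (x y : K) : P1 K := if y == 0 then None else Some (x / y).

Lemma P1_ofP x y : x * ycoord (P1_of x y) = y * xcoord (P1_of x y).
Proof.
rewrite /P1_of; case: eqVneq => [->|y0] /=; first by rewrite mulr0 mul0r.
by rewrite mulr1 mulrC divfK.
Qed.

(** Two pairs of homogeneous coordinates of the same point are proportional. *)
Lemma P1_cross x y x' y' p :
  x * ycoord p = y * xcoord p -> x' * ycoord p = y' * xcoord p -> x * y' = x' * y.
Proof.
case: p => [c|] /=; last by rewrite !mulr0 !mulr1 => <- <-; rewrite !mulr0.
by rewrite !mulr1 => -> ->; ring.
Qed.

Lemma P1_eq p p' : xcoord p * ycoord p' = xcoord p' * ycoord p -> p = p'.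
Proof.
case: p p' => [a|] [b|] //=; rewrite ?mulr1 ?mulr0 => e; first by rewrite e.
  by move/eqP: e; rewrite eq_sym oner_eq0.
by move/eqP: e; rewrite oner_eq0.
Qed.

(** The map of the projective line fixing [u] and [u + 1] induced by
    [scale_subst u a 1]. *)
Definition scale_x u a p := (u + 1) * a * lval u p - u * lval (u + 1) p.
Definition scale_y u a p := a * lval u p - lval (u + 1) p.
Definition scale_pt u a p := P1_of (scale_x u a p) (scale_y u a p).

Lemma scale_pt_inj u a : a != 0 -> injective (scale_pt u a).
Proof.
move=> a0 p p' e; apply: P1_eq.
have h := P1_ofP (scale_x u a p) (scale_y u a p).
have h' := P1_ofP (scale_x u a p') (scale_y u a p').
rewrite -/(scale_pt u a p') -e in h'.
have /eqP := P1_cross h h'; rewrite -subr_eq0.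
have -> : scale_x u a p * scale_y u a p' - scale_x u a p' * scale_y u a p
   = a * (xcoord p * ycoord p' - xcoord p' * ycoord p).
  by rewrite /scale_x /scale_y /lval; ring.
by rewrite mulf_eq0 (negPf a0) subr_eq0 => /eqP.
Qed.

(** As [t] tends to 0 the image of [p] tends to the point [u], which differs
    from [p'].  Hence the image equals [p'] only for finitely many [t]. *)
Lemma scale_pt_neq u p p' : lval (u + 1) p != 0 -> lval u p' != 0 ->
  exists2 g : {poly K}, g != 0 & forall t, g.[t] != 0 -> scale_pt u (t ^+ 2) p != p'.
Proof.
move=> p1 p0.
(* The cross product of [p'] with the image of [p], as a polynomial in [t]. *)
pose g : {poly K} := (lval u p * (xcoord p' - (u + 1) * ycoord p')) *: 'X ^+ 2
   - (lval (u + 1) p * lval u p')%:P.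
exists g => [|t gt].
  apply/eqP => /(congr1 (horner^~ 0)); rewrite !hornerE ?expr0n /= !(mulr0, mul0r, add0r).
  by move/eqP; rewrite oppr_eq0 mulf_eq0 (negPf p1) (negPf p0).
apply: contra gt => /eqP e.
have := P1_ofP (scale_x u (t ^+ 2) p) (scale_y u (t ^+ 2) p).
rewrite -/(scale_pt _ _ _) e => /eqP; rewrite -subr_eq0 -oppr_eq0 => /eqP h.
apply/eqP; rewrite -h /g hornerD hornerN hornerZ hornerXn hornerC /scale_x /scale_y /lval; ring.
Qed.

Lemma lval_neq0 o p :
  exists2 g : {poly K}, g != 0 & forall c, lval (c + o) p = g.[c].
Proof.
exists ((xcoord p - o * ycoord p)%:P - ycoord p *: 'X) => [|c]; last first.
  by rewrite hornerD hornerN hornerZ hornerX hornerC /lval; ring.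
apply/eqP => g0; have gE c : xcoord p - o * ycoord p - ycoord p * c = 0.
  have := congr1 (horner^~ c) g0.
  by rewrite hornerD hornerN hornerZ hornerX hornerC horner0.
move: (gE 0) (gE 1); rewrite mulr0 mulr1 subr0 => ->.
move/eqP; rewrite sub0r oppr_eq0; case: {g0} p gE => [a|] gE /=.
  by rewrite oner_eq0.
by have /eqP := gE 0; rewrite /= !mulr0 !subr0 oner_eq0.
Qed.

End Points.

(** An algebraically closed field is infinite. *)
Lemma exists_avoid (K : closedFieldType) (gs : seq {poly K}) :
  all (fun g => g != 0) gs -> exists t, all (fun g : {poly K} => g.[t] != 0) gs.
Proof.
move=> gs0; have : \prod_(g <- gs) g != 0.
  by elim: gs gs0 => [|g gs IH] /= => [_|/andP[g0 /IH]];
    rewrite ?big_nil ?oner_eq0 // big_cons mulf_eq0 (negPf g0).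
move/closed_nonrootP => [t]; rewrite /root horner_prod => nz; exists t.
by elim: gs nz {gs0} => [|g gs IH] //=; rewrite big_cons mulf_eq0 negb_or
  => /andP[-> /IH].
Qed.

Section MovePoint.
Variables (K : fieldType) (n : nat).
Implicit Types (p : P1n K n.+1) (F : {mpoly K[n.+1 + n.+1]}).

Definition move_pt (u a : K) p : P1n K n.+1 :=
  [ffun i => if i == ord_max then scale_pt u a (p i) else p i].

Lemma move_pt_inj u a : a != 0 -> injective (move_pt u a).
Proof.
move=> a0 p p' e; apply/ffunP => i; have := congr1 (fun f : {ffun _} => f i) e.
by rewrite !ffunE; case: eqP => // _ /(scale_pt_inj a0).
Qed.

Lemma local_chartx0 p i : (tnth (local_chart p) (lshift n.+1 i))@_0 = xcoord (p i).
Proof.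
rewrite local_chartl; case: (p i) => [a|] /=; last by rewrite mcoeff1 eqxx.
by rewrite mcoeffD mcoeffC eqxx mulr1 mcoeffX mnm1_eq0 addr0.
Qed.

Lemma local_charty0 p i : (tnth (local_chart p) (rshift n.+1 i))@_0 = ycoord (p i).
Proof.
rewrite local_chartr; case: (p i) => [a|] /=; first by rewrite mcoeff1 eqxx.
by rewrite mcoeffX mnm1_eq0.
Qed.

Lemma local_lform0 p c : (local_eq p (lform n c))@_0 = lval c (p ord_max).
Proof.
rewrite /local_eq /lform comp_mpolyB comp_mpolyZ !comp_mpolyXi.
by rewrite mcoeffB mcoeffZ local_chartx0 local_charty0.
Qed.

Lemma local_lformX0 p c e : lval c (p ord_max) != 0 ->
  (local_eq p (lform n c ^+ e))@_0 != 0.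
Proof. by move=> lp; rewrite /local_eq rmorphXn /= rmorphXn /= local_lform0 expf_neq0. Qed.

(** Composing the chart at [p] with the substitution gives a map through the
    moved point, so [ord_ge_comp] applies. *)
Lemma mult_ge_move (d : {ffun 'I_n.+1 -> nat}) u a p mu F :
  F \in multihomog K d -> mult_ge (move_pt u a p) mu F ->
  ord_ge mu (local_eq p (F \mPo scale_subst n u a 1)).
Proof.
move=> dF pF; rewrite /local_eq comp_mpolyA; apply: (ord_ge_comp dF pF) => i.
rewrite [tnth _ (lshift _ _)]tnth_mktuple [tnth _ (rshift _ _)]tnth_mktuple.
rewrite tnth_pairl tnth_pairr ffunE; case: eqP => [->|_].
  rewrite !comp_mpolyB !comp_mpolyZ -!/(local_eq p _) !mcoeffB !mcoeffZ.
  by rewrite !local_lform0 mulr1 mul1r; apply: P1_ofP.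
by rewrite !comp_mpolyXi local_chartx0 local_charty0 mulrC.
Qed.

End MovePoint.

(** * The degeneration *)

(** Homogeneity of degree [d ord_max] in the last pair of variables. *)
Lemma multihomog_last_scale (K : fieldType) n (d : {ffun 'I_n.+1 -> nat})
    (a : K) (F : {mpoly K[n.+1 + n.+1]}) :
  F \in multihomog K d ->
  F \mPo last_subst (a *: last_x K n) (a *: last_y K n) = a ^+ d ord_max *: F.
Proof.
move=> /allP dF; rewrite comp_mpolyEX [in RHS](mpolyE F) scaler_sumr.
rewrite big_seq [RHS]big_seq; apply: eq_bigr => M /dF/forallP/(_ ord_max)/eqP dM.
rewrite scalerA mulrC -scalerA; congr (_ *: _).
rewrite comp_mpolyX [in RHS]mpolyXE_id !big_split_ord /= -dM exprD.
rewrite (bigD1 ord_max) //= [X in _ * X](bigD1 ord_max) //=.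
rewrite [X in _ *: (X * _)](bigD1 ord_max) //= [X in _ *: (_ * X)](bigD1 ord_max) //=.
rewrite tnth_pairl tnth_pairr eqxx !exprZn -!scalerAl -scalerAr scalerA.
congr (_ *: (_ * _ * (_ * _))); apply: eq_bigr => i /negPf il.
  by rewrite tnth_pairl il.
by rewrite tnth_pairr il.
Qed.

Lemma scale_subst_diag (K : fieldType) n (u a : K) :
  scale_subst n u a a = last_subst (a *: last_x K n) (a *: last_y K n).
Proof.
by rewrite /scale_subst /lform; congr last_subst; rewrite -!mul_mpolyC; ring.
Qed.

Section Families.
Variables (K : fieldType) (n : nat) (d : {ffun 'I_n.+1 -> nat}) (k : nat) (u : K).
Hypotheses (k_gt0 : (0 < k)%N) (k_le : (k <= d ord_max)%N).
Let e := (d ord_max - k)%N.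
Let d1 := set_last d (k - 1).
Let d2 := set_last d e.
Implicit Types P Q : {mpoly K[n.+1 + n.+1]}.

(** For [t != 0] the pairs [(P, Q)] parametrize the forms of multidegree [d] by
    the far family.  Its substitution [scale_subst u 1 (t ^+ 2)] is a multiple
    of the inverse of [scale_subst u (t ^+ 2) 1].  Scaling by [t ^+ 2] rather
    than [t] leaves a spare factor [t] in each family, so that at [t = 0] the
    far family involves only [Q] and the near family only [P]. *)
Definition far_family (t : K) P Q : {mpoly K[n.+1 + n.+1]} :=
  t *: ((P \mPo scale_subst n u 1 (t ^+ 2)) * lform n (u + 1) ^+ e.+1)
  + Q * lform n u ^+ k.

Definition near_family (t : K) P Q : {mpoly K[n.+1 + n.+1]} :=
  P * lform n (u + 1) ^+ e.+1
  + t *: ((Q \mPo scale_subst n u (t ^+ 2) 1) * lform n u ^+ k).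

(** Both substitutions composed scale the last pair by [t ^+ 2], hence [P] by
    [t ^+ (2 * (k - 1))]; the other term acquires [t ^+ (2 * k)] from
    [lform u ^+ k].  Both share the factor [t ^+ (2 * k - 1)]. *)
Lemma far_family_scale t P Q : P \in multihomog K d1 ->
  far_family t P Q \mPo scale_subst n u (t ^+ 2) 1
  = t ^+ (k + k).-1 *: near_family t P Q.
Proof.
move=> dP; rewrite /far_family comp_mpolyD comp_mpolyZ !rmorphM !rmorphXn /=.
rewrite scale_subst_comp mulr1 mul1r lform_scale0 lform_scale1 scale1r.
rewrite scale_subst_diag (multihomog_last_scale _ dP) ffunE eqxx.
have -> : (t ^+ 2 *: lform n u) ^+ k = t ^+ (k + k) *: lform n u ^+ k.
  by rewrite -!mul_mpolyC exprMn -rmorphXn /= -exprM mul2n (addnn k).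
have kk : (k + k).-1 = (2 * (k - 1)).+1.
  by rewrite subn1; case: (k) k_gt0 => // k' _; rewrite addSn addnS addnn mul2n.
have -> : t ^+ (k + k) = t ^+ (k + k).-1 * t.
  by rewrite -exprSr prednK // addn_gt0 k_gt0.
have -> : t ^+ (k + k).-1 = t * t ^+ 2 ^+ (k - 1) by rewrite kk exprS exprM.
by rewrite /near_family -!mul_mpolyC !rmorphM /=; ring.
Qed.

Lemma far_family_mh t P Q : P \in multihomog K d1 -> Q \in multihomog K d2 ->
  far_family t P Q \in multihomog K d.
Proof.
move=> dP dQ; apply: rpredD; first apply: rpredZ.
  apply: (@multihomog_lformX _ _ _ (k - 1)); first exact: multihomog_scale.
  by rewrite /e addnS -addSn subn1 prednK // subnKC.
by apply: (multihomog_lformX _ dQ); rewrite /e subnK.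
Qed.

Lemma far_family_lin t c P Q P' Q' :
  far_family t (c *: P + P') (c *: Q + Q')
  = c *: far_family t P Q + far_family t P' Q'.
Proof.
rewrite /far_family comp_mpolyD comp_mpolyZ -!mul_mpolyC; ring.
Qed.

Lemma near_family_lin t c P Q P' Q' :
  near_family t (c *: P + P') (c *: Q + Q')
  = c *: near_family t P Q + near_family t P' Q'.
Proof.
rewrite /near_family comp_mpolyD comp_mpolyZ -!mul_mpolyC; ring.
Qed.

Definition far_form (t : K) (w : mform K d1 * mform K d2) : mform K d :=
  MForm (far_family_mh t (valP w.1) (valP w.2)).

Lemma far_form_linear t : linear (far_form t).
Proof. by move=> c v w; apply: val_inj; rewrite /= far_family_lin. Qed.

HB.instance Definition _ (t : K) :=
  GRing.isLinear.Build K (mform K d1 * mform K d2)%type (mform K d) _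
    (far_form t) (far_form_linear t).

(** Solve [split_last] for [P] and [Q]: for [t != 0] the substitution applied to
    [P] is invertible. *)
Lemma far_form_surj t (F : mform K d) : t != 0 -> exists w, far_form t w = F.
Proof.
move=> t0; have [A [B [dA dB FE]]] := split_last u k_le (valP F).
have dA' : t^-1 *: (A \mPo scale_subst n u 1 (t ^- 2)) \in multihomog K d1.
  by apply: rpredZ; apply: multihomog_scale.
exists (MForm dA', MForm dB); apply: val_inj; rewrite /= FE /far_family.
rewrite comp_mpolyZ scale_subst_comp mulr1 mulVf ?expf_neq0 // scale_subst11.
by rewrite -scalerAl scalerA divff // scale1r.
Qed.

(** By associativity only the substituted tuple depends on the parameters, and
    its entries are linear in them. *)
Lemma mpolyfun_scale (p : P1n K n.+1) Q (a b : K -> K) :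
  polyfun a -> polyfun b ->
  mpolyfun (fun t => local_eq p (Q \mPo scale_subst n u (a t) (b t))).
Proof.
move=> pa pb m.
pose T t := [tuple tnth (scale_subst n u (a t) (b t)) i \mPo local_chart p
            | i < n.+1 + n.+1].
apply: (@eq_polyfun _ (fun t => (Q \mPo T t)@_m)).
  by move=> t; rewrite /local_eq comp_mpolyA.
move: m; apply: mpolyfun_comp => i m.
have comb (f g : K -> K) (A B : {mpoly K[n.+1]}) : polyfun f -> polyfun g ->
    polyfun (fun t => (f t *: A - g t *: B)@_m).
  move=> pf pg; apply: (@eq_polyfun _ (fun t => f t * A@_m + g t * - B@_m)).
    by move=> t; rewrite mcoeffB !mcoeffZ mulrN.
  by apply: polyfunD; apply: polyfunM => //; apply: polyfunC.
rewrite -(splitK i); case: (split i) => {}i /=; case: (eqVneq i ord_max) => [il|il].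
- apply: (@eq_polyfun _ (fun t => ((u + 1) * a t *: local_eq p (lform n u)
     - (u * b t) *: local_eq p (lform n (u + 1)))@_m)).
    move=> t; rewrite tnth_mktuple tnth_pairl il eqxx comp_mpolyB !comp_mpolyZ.
    by [].
  by apply: comb; apply: polyfunM => //; apply: polyfunC.
- apply: eq_polyfun (polyfunC (local_eq p 'X_(lshift n.+1 i))@_m) => t.
  by rewrite tnth_mktuple tnth_pairl (negPf il).
- apply: (@eq_polyfun _ (fun t => (a t *: local_eq p (lform n u)
     - b t *: local_eq p (lform n (u + 1)))@_m)).
    move=> t; rewrite tnth_mktuple tnth_pairr il eqxx comp_mpolyB !comp_mpolyZ.
    by [].
  exact: comb.
- apply: eq_polyfun (polyfunC (local_eq p 'X_(rshift n.+1 i))@_m) => t.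
  by rewrite tnth_mktuple tnth_pairr (negPf il).
Qed.

Lemma polyfun_sqr : polyfun (fun t : K => t ^+ 2).
Proof. by exists 'X^2 => t; rewrite hornerXn. Qed.

Lemma mpolyfun_far p P Q : mpolyfun (fun t => local_eq p (far_family t P Q)).
Proof.
pose A t := local_eq p (P \mPo scale_subst n u 1 (t ^+ 2)).
suff pF : mpolyfun (fun t => t *: (A t * local_eq p (lform n (u + 1) ^+ e.+1))
    + local_eq p (Q * lform n u ^+ k)).
  move=> m; apply: eq_polyfun (pF m) => t.
  by rewrite /far_family /local_eq comp_mpolyD comp_mpolyZ [in RHS]rmorphM.
apply: mpolyfunD; last exact: mpolyfunC.
apply: mpolyfunZ (polyfun_id K) _; apply: mpolyfunM; last exact: mpolyfunC.
exact: mpolyfun_scale (polyfunC 1) polyfun_sqr.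
Qed.

Lemma mpolyfun_near p P Q : mpolyfun (fun t => local_eq p (near_family t P Q)).
Proof.
pose A t := local_eq p (Q \mPo scale_subst n u (t ^+ 2) 1).
suff pF : mpolyfun (fun t => local_eq p (P * lform n (u + 1) ^+ e.+1)
    + t *: (A t * local_eq p (lform n u ^+ k))).
  move=> m; apply: eq_polyfun (pF m) => t.
  by rewrite /near_family /local_eq comp_mpolyD comp_mpolyZ [X in _ = (_ + _ *: X)@_m]rmorphM.
apply: mpolyfunD; first exact: mpolyfunC.
apply: mpolyfunZ (polyfun_id K) _; apply: mpolyfunM; last exact: mpolyfunC.
exact: mpolyfun_scale polyfun_sqr (polyfunC 1).
Qed.

(** At [t = 0] only [Q * lform u ^+ k] is left, and the power of [lform u] is a
    unit at [p]. *)
Lemma far_family0 (p : P1n K n.+1) mu P Q : lval u (p ord_max) != 0 ->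
  ord_ge mu (local_eq p (far_family 0 P Q)) -> mult_ge p mu Q.
Proof.
move=> lp; rewrite /far_family scale0r add0r /local_eq rmorphM /= => o.
by apply/mult_geP; apply: ord_ge_unitr o; apply: local_lformX0.
Qed.

Lemma near_family0 (p : P1n K n.+1) mu P Q : lval (u + 1) (p ord_max) != 0 ->
  ord_ge mu (local_eq p (near_family 0 P Q)) -> mult_ge p mu P.
Proof.
move=> lp; rewrite /near_family scale0r addr0 /local_eq rmorphM /= => o.
by apply/mult_geP; apply: ord_ge_unitr o; apply: local_lformX0.
Qed.

End Families.

(** * The dimension bound and the theorem *)

(** [U] is the product [A * B], described by its two projections so that its
    dimension follows from rank-nullity. *)
Lemma dim_pair_bound (K : fieldType) (vT wT : vectType K)
    (A : {vspace vT}) (B : {vspace wT}) :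
  exists2 U : {vspace (vT * wT)%type}, (\dim U <= \dim A + \dim B)%N &
    forall w : vT * wT, w.1 \in A -> w.2 \in B -> w \in U.
Proof.
pose f := linfun (fst : vT * wT -> vT); pose g := linfun (snd : vT * wT -> wT).
exists ((f @^-1: A) :&: (g @^-1: B))%VS => [|w wA wB]; last first.
  by rewrite memv_cap -!memv_preim !lfunE wA wB.
set U := (_ :&: _)%VS.
rewrite -(limg_ker_dim f U) addnC leq_add //.
  apply: dimvS; apply/subvP => _ /memv_imgP[w /memv_capP[wA _] ->].
  by rewrite -memv_preim in wA.
rewrite -(limg_ker_dim g (U :&: lker f)).
have -> : (U :&: lker f :&: lker g = 0)%VS.
  apply/eqP; rewrite -subv0; apply/subvP => w.
  rewrite !memv_cap !memv_ker !lfunE => /andP[/andP[_ w1] w2].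
  by case: w w1 w2 => a b /= w1 w2; rewrite memv0 -pair_eqE /pair_eq /= w1 w2.
rewrite dimv0 add0n; apply: dimvS; apply/subvP => _ /memv_imgP[w + ->].
by case/memv_capP => /memv_capP[_ wB] _; rewrite -memv_preim in wB.
Qed.

Lemma dim_surj_preim (K : fieldType) (vT wT : vectType K)
    (f : {linear vT -> wT}) (X : {vspace wT}) :
  (forall x, exists v, f v = x) ->
  exists2 Y : {vspace vT}, (\dim X <= \dim Y)%N & forall v, v \in Y -> f v \in X.
Proof.
move=> f_surj; exists (linfun f @^-1: X)%VS => [|v]; last first.
  by rewrite -memv_preim lfunE.
have {1}-> : X = (linfun f @: (linfun f @^-1: X))%VS.
  rewrite lpreimK //; apply/subvP => x _; have [v <-] := f_surj x.
  by rewrite -[f v]lfunE memv_img ?memvf.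
by rewrite -(limg_ker_dim (linfun f) (_ @^-1: X)) leq_addl.
Qed.

Section Zip.
Variables (K : fieldType) (n r : nat) (p : r.-tuple (P1n K n)) (m : r.-tuple nat).
Variable d : {ffun 'I_n -> nat}.

Lemma mem_V_zip (F : mform K d) j :
  F \in V (LinSys d (zip p m)) -> mult_ge (tnth p j) (tnth m j) F.
Proof.
rewrite (@memV _ _ (LinSys d (zip p m)) F) => /all_tnthP /= /(_ j).
rewrite (tnth_nth (tnth p j, 0%N)) /= nth_zip ?size_tuple //=.
by rewrite -!tnth_nth.
Qed.

Lemma nth_zip_tnth x i (ir : (i < r)%N) :
  nth x (zip p m) i = (tnth p (Ordinal ir), tnth m (Ordinal ir)).
Proof.
rewrite (set_nth_default (x.1, x.2)) ?size_zip ?size_tuple ?minnn //.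
by rewrite nth_zip ?size_tuple // (tnth_nth x.1) (tnth_nth x.2).
Qed.

Lemma mem_take_zip s pm : pm \in take s (zip p m) ->
  exists2 j : 'I_r, (j < s)%N & pm = (tnth p j, tnth m j).
Proof.
case/(nthP pm) => i; rewrite size_take_min size_zip !size_tuple minnn ltn_min.
case/andP=> is_ ir; rewrite nth_take // (nth_zip_tnth _ ir) => <-.
by exists (Ordinal ir).
Qed.

Lemma mem_drop_zip s pm : pm \in drop s (zip p m) ->
  exists2 j : 'I_r, (s <= j)%N & pm = (tnth p j, tnth m j).
Proof.
case/(nthP pm) => i; rewrite size_drop size_zip !size_tuple minnn ltn_subRL => ir.
by rewrite nth_drop (nth_zip_tnth _ ir) => <-; exists (Ordinal ir); rewrite //= leq_addr.
Qed.

Lemma V_take (s : nat) (F : mform K d) :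
  (forall j : 'I_r, (j < s)%N -> mult_ge (tnth p j) (tnth m j) F) ->
  F \in V (LinSys d (take s (zip p m))).
Proof.
move=> H; rewrite (@memV _ _ (LinSys d (take s (zip p m))) F).
by apply/allP => _ /mem_take_zip[j js ->]; apply: H.
Qed.

Lemma V_drop (s : nat) (F : mform K d) :
  (forall j : 'I_r, (s <= j)%N -> mult_ge (tnth p j) (tnth m j) F) ->
  F \in V (LinSys d (drop s (zip p m))).
Proof.
move=> H; rewrite (@memV _ _ (LinSys d (drop s (zip p m))) F).
by apply/allP => _ /mem_drop_zip[j sj ->]; apply: H.
Qed.

End Zip.

(** The moved points [p] come from one parameter [t] at which the dimension of
    the common kernel is no larger than at 0 and at which [p] has distinct
    entries; both exclude only the roots of finitely many nonzero
    polynomials. *)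
Lemma degeneration_bound (K : closedFieldType) (n r : nat)
    (d : {ffun 'I_n.+1 -> nat}) (m : r.-tuple nat) (k s : nat)
    (q : r.-tuple (P1n K n.+1)) :
  (0 < k)%N -> (k <= d ord_max)%N -> uniq q ->
  exists2 p : r.-tuple (P1n K n.+1), uniq p &
    (\dim (V (LinSys d (zip p m)))
     <= \dim (V (LinSys (set_last d (k - 1)) (take s (zip q m))))
      + \dim (V (LinSys (set_last d (d ord_max - k)) (drop s (zip q m)))))%N.
Proof.
move=> k0 kd q_uniq; pose c j := tnth q j ord_max.
(* [u] and [u + 1] avoid the last coordinates of all the points. *)
have [u u0 u1] : exists2 u : K, forall j, lval u (c j) != 0 &
    forall j, lval (u + 1) (c j) != 0.
  have /fin_all_exists2[g g0 gE] j := lval_neq0 0 (c j).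
  have /fin_all_exists2[h h0 hE] j := lval_neq0 1 (c j).
  have [|u /allP ug] := @exists_avoid K ([seq g j | j : 'I_r] ++ [seq h j | j : 'I_r]).
    by rewrite all_cat; apply/andP; split; apply/allP => _ /mapP[j _ ->].
  exists u => j; [rewrite -[u]addr0 gE | rewrite hE]; apply: ug.
    by rewrite mem_cat map_f ?mem_enum.
  by rewrite mem_cat [X in _ || X]map_f ?orbT ?mem_enum.
set V1 := V _; set V2 := V _.
have [U Udim UP] := dim_pair_bound V1 V2.
set d1 := set_last d (k - 1) in V1 V2 U Udim UP *.
set d2 := set_last d (d ord_max - k) in V1 V2 U Udim UP *.
(* The points with index below [s] are the ones that move. *)
pose fam (j : 'I_r) t (w : mform K d1 * mform K d2) :=
  if (j < s)%N then near_family d k u t w.1 w.2 else far_family d k u t w.1 w.2.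
pose phi (i : {j : 'I_r & 'X_{1..n.+1 < tnth m j}}) t w :=
  (local_eq (tnth q (tag i)) (fam (tag i) t w))@_(tagged i).
have phi_ord t w : (forall i, phi i t w = 0) ->
    forall j, ord_ge (tnth m j) (local_eq (tnth q j) (fam j t w)).
  by move=> H j M lM; exact: (H (existT _ j (BMultinom lM))).
have [] := @semicontinuity K _ _ phi U.
- move=> i t a v w; rewrite /phi /fam /local_eq /=; case: ifP => _.
    by rewrite near_family_lin comp_mpolyD comp_mpolyZ mcoeffD mcoeffZ.
  by rewrite far_family_lin comp_mpolyD comp_mpolyZ mcoeffD mcoeffZ.
- move=> i w; rewrite /phi /fam; case: (tag i < s)%N; first exact: mpolyfun_near.
  exact: mpolyfun_far.
- move=> w /phi_ord wo; apply: UP.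
    apply: V_take => j js; have := wo j; rewrite /fam js.
    exact: near_family0 (u1 j).
  apply: V_drop => j sj; have := wo j; rewrite /fam ltnNge sj /=.
  exact: far_family0 (u0 j).
move=> g g0 gP.
have /fin_all_exists2[h h0 hE] (ij : 'I_r * 'I_r) :=
  scale_pt_neq (u1 ij.1) (u0 ij.2).
have [|t] := @exists_avoid K ('X :: g :: [seq h ij | ij : 'I_r * 'I_r]).
  by rewrite /= polyX_eq0 g0; apply/allP => _ /mapP[ij _ ->].
rewrite /= hornerX => /and3P[t0 gt /allP ht].
have tt0 : t ^+ 2 != 0 by rewrite expf_neq0.
pose pt (j : 'I_r) :=
  if (j < s)%N then move_pt u (t ^+ 2) (tnth q j) else tnth q j.
have q_inj : injective (tnth q) by apply/tuple_uniqP.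
have pt_neq i j : move_pt u (t ^+ 2) (tnth q i) != tnth q j.
  apply/eqP => /(congr1 (fun f : {ffun _} => f ord_max)); rewrite ffunE eqxx.
  by apply/eqP; apply: (hE (i, j)); apply: ht; rewrite map_f ?mem_enum.
exists [tuple pt j | j < r].
  apply/tuple_uniqP => i j; rewrite !tnth_mktuple /pt.
  case: ifP => _; case: ifP => _.
  - by move/(move_pt_inj tt0)/q_inj.
  - by move/eqP; rewrite (negPf (pt_neq _ _)).
  - by move/esym/eqP; rewrite (negPf (pt_neq _ _)).
  - exact: q_inj.
set X := V _.
(* Pull the system at the moved points back to pairs (P, Q). *)
have [Y XY YP] := dim_surj_preim X
  (fun F => far_form_surj u k0 kd F t0).
apply: leq_trans XY (leq_trans _ Udim); apply: (gP t) => // w /YP wX [j [M lM]].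
rewrite /phi /=; suff : ord_ge (tnth m j) (local_eq (tnth q j) (fam j t w)).
  by apply.
have := mem_V_zip j wX; rewrite tnth_mktuple /pt /fam; case: ifP => _; last first.
  by move/mult_geP.
move/(mult_ge_move (valP (far_form u k0 kd t w))).
rewrite /= far_family_scale ?(valP w.1) // => o M' lM'.
have := o M' lM'; rewrite /local_eq comp_mpolyZ mcoeffZ => /eqP.
by rewrite mulf_eq0 expf_eq0 (negPf t0) andbF /= => /eqP.
Qed.

(** The contribution of one point of multiplicity [mu] to the formula for the
    fiber dimension. *)
Definition fcond n (d : {ffun 'I_n -> nat}) (mu : nat) : int :=
  \sum_(I : {set 'I_n} | (S_ d I <= mu)%N)
    (-1) ^+ #|I| * 'C(mu - S_ d I + n, n)%:Z.

(** A set [I] containing the last index has [S_ d I >= d ord_max + 2], which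
    exceeds [mu], and likewise for the smaller last degree [e].  For the other
    sets [S_ d I] does not depend on the last degree. *)
Lemma fcond_set_last n (d : {ffun 'I_n.+1 -> nat}) e mu :
  (mu <= e.+1)%N -> (e <= d ord_max)%N -> fcond (set_last d e) mu = fcond d mu.
Proof.
move=> mue ed; rewrite /fcond.
have SE (I : {set 'I_n.+1}) : ord_max \notin I -> S_ (set_last d e) I = S_ d I.
  move=> lI; congr (_ + _)%N; apply: eq_bigr => i iI; rewrite ffunE.
  by case: eqP => // il; rewrite -il iI in lI.
have S_big (d' : {ffun 'I_n.+1 -> nat}) (I : {set 'I_n.+1}) :
    ord_max \in I -> ((d' ord_max).+2 <= S_ d' I)%N.
  move=> lI; rewrite /S_ (bigD1 ord_max) //=.
  have : (0 < #|I|)%N by rewrite card_gt0; apply/set0Pn; exists ord_max.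
  rewrite addnA -addn2 addnC => I0; apply: leq_trans (leq_addr _ _).
  by rewrite leq_add2r add1n ltnS.
have lt1 (I : {set 'I_n.+1}) : ord_max \in I -> (mu < S_ (set_last d e) I)%N.
  move/(S_big (set_last d e)); rewrite ffunE eqxx; exact: leq_ltn_trans.
have lt2 (I : {set 'I_n.+1}) : ord_max \in I -> (mu < S_ d I)%N.
  by move/(S_big d); apply: leq_trans; rewrite ltnS (leq_trans mue) // ltnS.
apply: eq_big => [I|I]; case: (boolP (ord_max \in I)) => lI.
- by rewrite leqNgt lt1 // leqNgt lt2.
- by rewrite SE.
- by rewrite leqNgt lt1.
- by rewrite SE.
Qed.

(** The products add up because [k + (d ord_max - k + 1) = d ord_max + 1]; the
    correction sums split along the points, where each term is the same for all
    three systems by [fcond_set_last]. *)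
Lemma fdim_additive (K : fieldType) (n r : nat) (d : {ffun 'I_n.+1 -> nat})
    (m : r.-tuple nat) (k s : nat) (q : r.-tuple (P1n K n.+1)) :
  (0 < k)%N -> (k <= d ord_max)%N ->
  (forall i : 'I_r, (i < s)%N -> (tnth m i <= k)%N) ->
  (forall j : 'I_r, (s <= j)%N -> (tnth m j <= d ord_max - k + 1)%N) ->
  fdim (LinSys d (zip q m)) + 1
  = (fdim (LinSys (set_last d (k - 1)) (take s (zip q m))) + 1)
    + (fdim (LinSys (set_last d (d ord_max - k)) (drop s (zip q m))) + 1).
Proof.
move=> k0 kd m1 m2; rewrite /fdim /= !subrK.
have -> : (\prod_i (d i).+1)%N
   = (\prod_i (set_last d (k - 1) i).+1
      + \prod_i (set_last d (d ord_max - k) i).+1)%N.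
  have E e : (\prod_i (set_last d e i).+1
      = e.+1 * \prod_(i < n.+1 | i != ord_max) (d i).+1)%N.
    rewrite (bigD1 ord_max) //= ffunE eqxx; congr (_ * _)%N.
    by apply: eq_bigr => i /negPf il; rewrite ffunE il.
  rewrite (bigD1 ord_max) //= !E -mulnDl; congr (_ * _)%N.
  by rewrite subn1 prednK // addnS subnKC.
rewrite PoszD -{1}(cat_take_drop s (zip q m)) big_cat /= opprD addrACA.
congr (_ - _ + (_ - _)); apply: eq_big_seq => pm.
  case/mem_take_zip => j js -> /=; rewrite -!/(fcond _ _); symmetry.
  apply: fcond_set_last; last lia.
  by rewrite subn1 prednK // m1.
case/mem_drop_zip => j js -> /=; rewrite -!/(fcond _ _); symmetry.
apply: fcond_set_last; last lia.
by rewrite -addn1 m2.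
Qed.

Theorem theorem4p1 (K : closedFieldType) (n r : nat)
    (n_ge2 : (2 <= n.+1)%N) (r_ge1 : (1 <= r)%N)
    (d : {ffun 'I_n.+1 -> nat}) (m : r.-tuple nat)
    (k : nat) (k_ge1 : (1 <= k)%N) (k_le : (k <= d ord_max)%N)
    (s : nat) (s_ge1 : (1 <= s)%N) (s_le : (s <= r)%N)
    (q : r.-tuple (P1n K n.+1)) (q_vgen : very_general q)
    (L1 := LinSys (set_last d (k - 1)) (take s (zip q m)))
    (L2 := LinSys (set_last d (d ord_max - k)) (drop s (zip q m)))
    (L := LinSys d (zip q m))
    (L1_nonspecial : ~~ fiber_special L1)
    (L2_nonspecial : ~~ fiber_special L2)
    (fdim_sign : (fdim L1 + 1) * (fdim L2 + 1) >= 0)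
    (m_le1 : forall i : 'I_r, (i < s)%N -> (tnth m i <= k)%N)
    (m_le2 : forall j : 'I_r, (s <= j)%N -> (tnth m j <= d ord_max - k + 1)%N) :
  ~~ fiber_special L.
Proof.
have q_uniq := q_vgen.1.
have [p p_uniq dim_le] := degeneration_bound m s k_ge1 k_le q_uniq.
have := leq_trans (q_vgen.2 d m p p_uniq) dim_le.
have := fdim_additive q k_ge1 k_le m_le1 m_le2.
rewrite -/L -/L1 -/L2.
move: L1_nonspecial L2_nonspecial fdim_sign {dim_le}.
rewrite /fiber_special /efdim /Defs.dim -!leNgt !le_max.
move: (fdim L) (fdim L1) (fdim L2) => f f1 f2.
move: (\dim (V L)) (\dim (V L1)) (\dim (V L2)) => v v1 v2 h1 h2 hs fE vle.
(* The positive part is additive on numbers that are not of opposite signs. *)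
have [[f1_ge f2_ge]|[f1_le f2_le]] :
    (0 <= f1 + 1 /\ 0 <= f2 + 1) \/ (f1 + 1 <= 0 /\ f2 + 1 <= 0) by nia.
  lia.
lia.
Qed.
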